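(* Let $h>0$, $t_0\in\mathbb{R}$, let $f:\mathbb{R}^n\times\mathbb{R}^m\to\mathbb{R}^n$ be $C^1$, and let $y:[t_0,t_0+h]\to\mathbb{R}^m$ be bounded and measurable. Let $\mathbb{R}^n=\bigoplus_{i=1}^{p}\mathbb{R}^{n_i}$ be a decomposition into blocks, each $\mathbb{R}^{n_i}$ being equipped with a norm. Let $W_y\subset\mathbb{R}^m$ be convex with $y([t_0,t_0+h])\subset W_y$, and let $y_c\in W_y$. Assume that $x_1,x_2:[t_0,t_0+h]\to\mathbb{R}^n$, both absolutely continuous, are weak solutions of, respectively, $$x_1'=f(x_1,y_c),\quad x_1(t_0)=x_0,\qquad\qquad x_2'=f(x_2,y(t)),\quad x_2(t_0)=\bar x_0 .$$ Let $W_1\subset W_2\subset\mathbb{R}^n$ be convex and compact sets such that $x_1(t)\in W_1$ and $x_2(t)\in W_2$ for all $t\in[t_0,t_0+h]$. Put $$\Delta=\{f(x,y_c)-f(x,y)\;:\;x\in W_1,\ y\in W_y\},$$ and let $C\in\mathbb{R}^p$ and $J\in\mathbb{R}^{p\times p}$ satisfy $$C_i\ \ge\ \sup_{\delta\in\Delta}\|\delta_i\|\quad(i=1,\dots,p),$$ $$J_{ii}\ \ge\ \sup_{x\in W_2,\,y\in W_y}\mu\!\left(\frac{\partial f_i}{\partial x_i}(x,y)\right),\qquad J_{ij}\ \ge\ \sup_{x\in W_2,\,y\in W_y}\left\|\frac{\partial f_i}{\partial x_j}(x,y)\right\|\quad(i\ne j).$$ Then for all $t\in[t_0,t_0+h]$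 and $i=1,\dots,p$, $$\|x_{1,i}(t)-x_{2,i}(t)\|\ \le\ \left(e^{J(t-t_0)}\,|x_0-\bar x_0|\right)_i+\left(\int_{t_0}^{t}e^{J(t-s)}C\,ds\right)_i,$$ where $|x_0-\bar x_0|\in\mathbb{R}^p$ is the vector with $i$-th entry $\|x_{0,i}-\bar x_{0,i}\|$.
   Context: Block notation: for $z\in\mathbb{R}^n=\bigoplus_{i=1}^p\mathbb{R}^{n_i}$, $z_i\in\mathbb{R}^{n_i}$ denotes its $i$-th block component; $x_{1,i}(t)$ is the $i$-th block of $x_1(t)$, and $f_i$ is the $i$-th block of $f$. The block $\frac{\partial f_i}{\partial x_j}(x,y)$ of the Jacobian matrix of $f$ with respect to $x$ is a linear map $\mathbb{R}^{n_j}\to\mathbb{R}^{n_i}$; $\|\cdot\|$ of it is the operator norm induced by the chosen norms on the blocks. Logarithmic norm: for a square matrix $A$ and a vector norm with its subordinate operator norm, $\mu(A)=\lim_{h\to0^+}\frac{\|I+hA\|-1}{h}$. For the diagonal blocks, $\mu$ is taken with respect to the norm on $\mathbb{R}^{n_i}$. Weak solution: an absolutely continuous function $x$ on an interval $D\ni t_0$ is a weak solution of $x'=f(x,y(t))$, $x(t_0)=x_0$ if $x(t)=x_0+\int_{t_0}^t f(x(s),y(s))\,ds$ (Lebesgue integral) for all $t\in D$. *)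

(* Defs.v *)
From HB Require Import structures.
From mathcomp Require Import all_boot all_order all_algebra.
From mathcomp Require Import all_classical all_reals all_analysis.

Set Implicit Arguments.
Unset Strict Implicit.
Unset Printing Implicit Defensive.

Import Order.TTheory GRing.Theory Num.Theory.
Import numFieldNormedType.Exports.

Local Open Scope classical_set_scope.
Local Open Scope ring_scope.

(* Vectors are row vectors: a linear map R^a -> R^b
   is a matrix M : 'M_(a, b) acting by v |-> v *m M, as in the library's
   [jacobian]. A space with p blocks of sizes n_ i is 'rV_(\sum_(i < p) n_ i),
   the i-th block of z being [submxrow z i]. *)

Definition is_norm (R : realType) (n : nat) (N : 'rV[R]_n -> R) : Prop :=
  [/\ forall v w, N (v + w) <= N v + N w,
      forall a v, N (a *: v) = `|a| * N v &
      forall v, N v = 0 -> v = 0].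

(* For norms NV, NW this is a supremum of a nonempty bounded set of reals. *)
Definition opnorm (R : realType) (a b : nat)
    (NV : 'rV[R]_a -> R) (NW : 'rV[R]_b -> R) (M : 'M[R]_(a, b)) : R :=
  sup [set NW (v *m M) | v in [set v | NV v <= 1]].

Definition lognorm (R : realType) (n : nat) (N : 'rV[R]_n -> R)
    (A : 'M[R]_n) : R :=
  lim ((opnorm N N (1%:M + h *: A) - 1) / h @[h --> 0^'+]).

(* In finite dimension, continuity of z |-> 'd f z v for every v is the same as
   continuity of z |-> 'd f z in operator norm. *)
Definition C1 (R : realType) (V W : normedModType R) (f : V -> W) : Prop :=
  (forall z, differentiable f z) /\
  (forall v, continuous (fun z => 'd f z v)).

(* The block df_i/dx_j (x, y). It is the (j, i) block of the library's
   Jacobian because the latter acts on row vectors. *)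
Definition jac_block (R : realType) (p : nat) (n_ : 'I_p -> nat) (m : nat)
    (f : 'rV[R]_(\sum_(i < p) n_ i) * 'rV[R]_m -> 'rV[R]_(\sum_(i < p) n_ i))
    (i j : 'I_p) (x : 'rV[R]_(\sum_(i < p) n_ i)) (y : 'rV[R]_m) :
    'M[R]_(n_ j, n_ i) :=
  submxblock ('J (fun x' => f (x', y)) x) j i.

Definition expmx (R : realType) (n : nat) (A : 'M[R]_n) : 'M[R]_n :=
  limn (series (fun k : nat => (k`!%:R)^-1 *: A ^+ k)).

Definition int_mx d (T : measurableType d) (R : realType)
    (mu : {measure set T -> \bar R}) (a b : nat) (D : set T)
    (F : T -> 'M[R]_(a, b)) : 'M[R]_(a, b) :=
  \matrix_(i, j) \int[mu]_(s in D) F s i j.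

Definition integrable_mx d (T : measurableType d) (R : realType)
    (mu : {measure set T -> \bar R}) (a b : nat) (D : set T)
    (F : T -> 'M[R]_(a, b)) : Prop :=
  forall i j, mu.-integrable D (fun s => (F s i j)%:E).

(* The reals with the sigma-algebra of Lebesgue (not only Borel) measurable
   sets; it is the domain of [completed_lebesgue_measure]. *)
Definition lebesgueR (R : realType) : measurableType _ :=
  caratheodory_type ((@wlength R idfun)^*)%mu.

Definition lebesgue_measurable_mx (R : realType) (a b : nat) (D : set R)
    (F : R -> 'M[R]_(a, b)) : Prop :=
  forall i j, measurable_fun (D : set (lebesgueR R))
    ((fun s => F s i j) : lebesgueR R -> R).

Definition absolutely_continuous (R : realType) (n : nat) (a b : R)
    (x : R -> 'rV[R]_n) : Prop :=
  forall e : R, 0 < e -> exists2 d : R, 0 < d &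
    forall (k : nat) (u v : 'I_k -> R),
      (forall j, a <= u j /\ u j <= v j /\ v j <= b) ->
      trivIset setT (fun j => `]u j, v j[%classic) ->
      \sum_(j < k) (v j - u j) < d ->
      \sum_(j < k) `|x (v j) - x (u j)| < e.

(* Weak solutions of x' = f (x, y(t)), x(t0) = x0 on [t0, t0 + h]. A
   non-integrable integrand would get a junk integral, so integrability is
   part of the integral equation. *)
Definition weak_solution (R : realType) (n m : nat)
    (f : 'rV[R]_n * 'rV[R]_m -> 'rV[R]_n) (y : R -> 'rV[R]_m)
    (t0 h : R) (x0 : 'rV[R]_n) (x : R -> 'rV[R]_n) : Prop :=
  [/\ absolutely_continuous t0 (t0 + h) x,
      integrable_mx (@completed_lebesgue_measure R)
        `[t0, t0 + h]%classic (fun s => f (x s, y s)) &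
      forall t, t0 <= t <= t0 + h ->
        x t = x0 + int_mx (@completed_lebesgue_measure R)
                     `[t0, t]%classic (fun s => f (x s, y s))].

(* Main.v *)
Require Import Defs.
From HB Require Import structures.
From mathcomp Require Import all_boot all_order all_algebra.
From mathcomp Require Import all_classical all_reals all_analysis.
From mathcomp Require Import ring lra.

Set Implicit Arguments.
Unset Strict Implicit.
Unset Printing Implicit Defensive.

Import Order.TTheory GRing.Theory Num.Theory.
Import numFieldNormedType.Exports.

Local Open Scope classical_set_scope.
Local Open Scope ring_scope.

(** The error x1 - x2 is compared, block by block, with the solution z of the
    linear system z' = J z + C, z(t0) = |x0 - xbar0|; the right-hand side of the
    estimate is the variation of constants formula for z.

    The first half of the proof ([error_dini]) shows that the block norms
    w_i(t) = N_i (x1_i(t) - x2_i(t)) satisfy, at every time s, the one-sided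
    inequality w_i(s + k) <= w_i(s) + k ((J w(s))_i + C_i + o(1)) as k decreases
    to 0. Over [s, s + k] the increment of x1 - x2 is the integral of
    f (x1, yc) - f (x2, y). Along a functional of norm one that attains the norm
    at x1_i(s + k) - x2_i(s + k) ([norming_functional], a finite-dimensional
    Hahn-Banach theorem) the integral becomes scalar, so that it suffices to
    bound N_i (x1_i(s) - x2_i(s) + k v_i) for every value v of the integrand.
    Continuity of f allows x1 and x2 to be frozen at time s, uniformly in the
    bounded values of y ([uniform_near_compact]); then
    v = (f (x1, yc) - f (x1, y)) + (f (x1, y) - f (x2, y)). The first
    difference lies in Delta and costs k C_i. For the second, the mean value
    theorem on the segment from x2 to x1 ([block_mean_value]) leaves the norm of
    I + k df_i/dx_i on the i-th block and the norms of the df_i/dx_j on the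
    others. The former is at most 1 + k (J_ii + o(1)), uniformly over the
    relevant Jacobians: the quotient defining the logarithmic norm is monotone
    in k, and compactness gives the uniformity
    ([lognorm_quotient_uniform]). All bounds hold for every value of y in Wy, so
    the inequality holds at every s, and no differentiation almost everywhere is
    involved.

    The second half is a comparison. A continuous d with d(t0) <= 0 that
    satisfies d(s + k) <= d(s) + k (J d(s) + o(1)), with J nonnegative off the
    diagonal, stays nonpositive ([dini_nonpos]); this is applied to d = w - z.
    That z solves the linear system is read off the power series of the entries
    of the matrix exponential and of its primitive ([affine_flow_is_derive],
    [affine_flowE]). *)

(** * Norming functionals in finite dimension *)

Section LinearMinorant.
Variables (R : realType) (n : nat).
Implicit Types (p q : 'rV[R]_n -> R) (v w z : 'rV[R]_n).

Definition sublinear p : Prop :=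
  (forall v w, p (v + w) <= p v + p w) /\
  (forall (a : R) v, 0 <= a -> p (a *: v) = a * p v).

Lemma sublinear0 p : sublinear p -> p 0 = 0.
Proof. by move=> [_ pZ]; rewrite -(scale0r 0) pZ// mul0r. Qed.

Lemma sublinear_addN_ge0 p v : sublinear p -> 0 <= p v + p (- v).
Proof. by move=> sp; rewrite -(sublinear0 sp) -{1}(subrr v) sp.1. Qed.

(** The largest sublinear functional below [p] whose value at [- z] is at most
    [- p z], i.e. that is linear along [z]. *)
Definition straighten p z v : R :=
  inf [set p (v + t *: z) - t * p z | t in [set t : R | 0 <= t]].

Let straighten_has_inf p z v : sublinear p ->
  has_inf [set p (v + t *: z) - t * p z | t in [set t : R | 0 <= t]].
Proof.
move=> sp; split; first by exists (p (v + 0 *: z) - 0 * p z); exists 0 => /=.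
exists (- p (- v)) => _ [t /= t0 <-].
rewrite lerBrDl -sp.2// lerBlDr.
by rewrite (le_trans _ (sp.1 _ _))// addrAC subrr add0r.
Qed.

Lemma straighten_le_at p z v (t : R) : sublinear p -> 0 <= t ->
  straighten p z v <= p (v + t *: z) - t * p z.
Proof.
move=> sp t0; apply: ge_inf; last by exists t.
exact: (straighten_has_inf _ _ sp).2.
Qed.

Lemma le_straighten p z v c : sublinear p ->
  (forall t : R, 0 <= t -> c <= p (v + t *: z) - t * p z) -> c <= straighten p z v.
Proof.
move=> sp h; apply: lb_le_inf; first exact: (straighten_has_inf _ _ sp).1.
by move=> _ [t /= t0 <-]; exact: h.
Qed.

Lemma straighten_le p z v : sublinear p -> straighten p z v <= p v.
Proof.
move=> sp; apply: (le_trans (straighten_le_at z v sp (lexx 0))).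
by rewrite scale0r addr0 mul0r subr0.
Qed.

Lemma straighten_opp p z : sublinear p -> straighten p z (- z) <= - p z.
Proof.
move=> sp; apply: (le_trans (straighten_le_at z (- z) sp ler01)).
by rewrite scale1r addNr sublinear0// mul1r sub0r.
Qed.

Lemma straighten_sublinear p z : sublinear p -> sublinear (straighten p z).
Proof.
move=> sp; split=> [v w|].
  rewrite -lerBlDr; apply: le_straighten => // t t0.
  rewrite lerBlDr -lerBlDl; apply: le_straighten => // s s0.
  rewrite lerBlDl; apply: (le_trans (straighten_le_at z _ sp (addr_ge0 t0 s0))).
  have := sp.1 (v + t *: z) (w + s *: z).
  rewrite addrACA -scalerDl mulrDl => le_p.
  by rewrite addrACA -opprD lerD2r.
have le (a : R) v : 0 < a -> straighten p z (a *: v) <= a * straighten p z v.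
  move=> a0; rewrite mulrC -ler_pdivrMr//.
  apply: le_straighten => // t t0; rewrite ler_pdivrMr//.
  apply: (le_trans (straighten_le_at z _ sp (mulr_ge0 (ltW a0) t0))).
  by rewrite -scalerA -scalerDr (sp.2 _ _ (ltW a0)); lra.
move=> a v; rewrite le_eqVlt => /predU1P[<-|a0].
  rewrite scale0r mul0r; apply/eqP; rewrite eq_le; apply/andP; split.
    by rewrite (le_trans (straighten_le z 0 sp))// sublinear0.
  by apply: le_straighten => // t t0; rewrite add0r sp.2// subrr.
apply/eqP; rewrite eq_le le//=.
rewrite mulrC -ler_pdivlMr//.
rewrite -[in leLHS](scale1r v) -(mulVf (lt0r_neq0 a0)) -scalerA mulrC.
by rewrite le// invr_gt0.
Qed.

Lemma straighten_seq p (zs : seq 'rV[R]_n) : sublinear p ->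
  exists q, [/\ sublinear q, forall v, q v <= p v &
    forall z, z \in zs -> q (- z) = - q z].
Proof.
move=> sp; elim: zs => [|z zs [q [sq qp qN]]]; first by exists p.
have sf := straighten_sublinear z sq.
exists (straighten q z); split=> [|v|z']; first exact: straighten_sublinear.
  exact: le_trans (straighten_le z v sq) (qp v).
move=> z'zs; apply/eqP; rewrite eq_le; apply/andP; split; last first.
  by have := sublinear_addN_ge0 z' sf; lra.
move: z'zs; rewrite inE => /predU1P[->|/qN qz'].
  by rewrite (le_trans (straighten_opp z sq))// lerN2 straighten_le.
by rewrite (le_trans (straighten_le z _ sq))// qz' lerN2 straighten_le.
Qed.

(** Hahn-Banach in finite dimension: straightening a sublinear functional along
    every basis vector makes it linear; straightening it along [z] beforehand
    forces the value at [z]. *)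
Lemma norming_functional p z : sublinear p ->
  exists l : 'cV[R]_n,
    (forall v, (v *m l) 0 0 <= p v) /\ (z *m l) 0 0 = p z.
Proof.
move=> sp; have sf := straighten_sublinear z sp.
have [q [sq qp qN]] := straighten_seq [seq delta_mx 0 k | k <- enum 'I_n] sf.
have {}qN k : q (- delta_mx 0 k) = - q (delta_mx 0 k).
  by apply: qN; apply/mapP; exists k; rewrite ?mem_enum.
pose l : 'cV[R]_n := \col_k q (delta_mx 0 k).
have qZ a k : q (a *: delta_mx 0 k) = a * q (delta_mx 0 k).
  have [a0|a0] := leP 0 a; first by rewrite sq.2.
  rewrite -[a]opprK scaleNr -scalerN sq.2 ?qN ?mulrN ?mulNr//.
  by rewrite oppr_ge0 ltW.
have ql v : q v <= (v *m l) 0 0.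
  rewrite {1}[v]row_sum_delta mxE.
  under [leRHS]eq_bigr do rewrite !mxE -qZ.
  elim/big_rec2: _ => [|k y1 y2 _ IH]; first by rewrite sublinear0.
  by rewrite (le_trans (sq.1 _ _))// lerD2l.
have lq v : (v *m l) 0 0 = q v.
  apply/eqP; rewrite eq_le ql andbT.
  have := ql (- v); rewrite mulNmx mxE.
  by have := sublinear_addN_ge0 v sq; lra.
exists l; split=> [v|].
  by rewrite lq (le_trans (qp v))// straighten_le.
apply/eqP; rewrite lq eq_le (le_trans (qp z))/= ?straighten_le//.
have := le_trans (qp (- z)) (straighten_opp z sp).
by have := sublinear_addN_ge0 z sq; lra.
Qed.

End LinearMinorant.

(** * Norms, operator norms and logarithmic norms *)

Lemma entry_le_norm (R : realType) (a b : nat) (M : 'M[R]_(a, b)) i j :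
  `|M i j| <= `|M|.
Proof.
rewrite [leRHS](mx_normrE M).
exact: (le_bigmax _ (fun ij => `|M ij.1 ij.2|) (i, j)).
Qed.

Lemma norm_le_entries (R : realType) (a b : nat) (M : 'M[R]_(a, b)) (K : R) :
  0 <= K -> (forall i j, `|M i j| <= K) -> `|M| <= K.
Proof.
move=> K0 MK; rewrite [leLHS](mx_normrE M).
by apply/bigmax_leP; split=> // -[i j] _; exact: MK.
Qed.

Section NormFacts.
Variables (R : realType) (n : nat) (N : 'rV[R]_n -> R).
Hypothesis hN : is_norm N.
Implicit Types v w : 'rV[R]_n.

Lemma is_normD v w : N (v + w) <= N v + N w.
Proof. by case: hN. Qed.

Lemma is_normZ (a : R) v : N (a *: v) = `|a| * N v.
Proof. by case: hN. Qed.

Lemma is_norm_sublinear : sublinear N.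
Proof.
by split=> [v w|a v a0]; [exact: is_normD|rewrite is_normZ ger0_norm].
Qed.

Lemma is_norm0 : N 0 = 0.
Proof. exact: sublinear0 is_norm_sublinear. Qed.

Lemma is_normN v : N (- v) = N v.
Proof. by rewrite -scaleN1r is_normZ normrN1 mul1r. Qed.

Lemma is_norm_ge0 v : 0 <= N v.
Proof. by have := sublinear_addN_ge0 v is_norm_sublinear; rewrite is_normN; lra. Qed.

Lemma is_norm_gt0 v : v != 0 -> 0 < N v.
Proof.
move=> v0; rewrite lt_def is_norm_ge0 andbT; apply: contra v0 => /eqP Nv.
by case: hN => _ _ N0; apply/eqP/N0.
Qed.

Lemma is_normB v w : N v - N w <= N (v - w).
Proof. by rewrite lerBlDr -{1}(subrK w v) is_normD. Qed.

Lemma is_norm_dist v w : `|N v - N w| <= N (v - w).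
Proof.
rewrite ler_norml is_normB andbT lerNl opprB.
by rewrite -(opprB w v) is_normN is_normB.
Qed.

Lemma is_norm_le : exists2 K : R, 0 < K & forall v, N v <= K * `|v|.
Proof.
exists (1 + \sum_k N (delta_mx 0 k)) => [|v].
  by rewrite ltr_pwDl// sumr_ge0// => k _; exact: is_norm_ge0.
rewrite mulrDl mul1r -[leLHS]add0r lerD// {1}[v]row_sum_delta mulr_suml.
elim/big_rec2: _ => [|k y1 y2 _ IH]; first by rewrite is_norm0.
rewrite (le_trans (is_normD _ _))// lerD// is_normZ mulrC ler_wpM2l//.
  exact: is_norm_ge0.
exact: entry_le_norm.
Qed.

Lemma is_norm_continuous : continuous N.
Proof.
have [K K0 NK] := is_norm_le.
move=> v.
have Nv (e : R) : 0 < e -> \forall w \near v, `|N v - N w| <= e.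
  move=> e0; apply/nbhs_normP; exists (e / K) => [|w /=]; first exact: divr_gt0.
  rewrite ltr_pdivlMr// mulrC => /ltW vw.
  by rewrite (le_trans (is_norm_dist _ _))// (le_trans (NK _)).
apply/(@cvgrPdist_le R R^o _ _ (nbhs_filter v)) => e e0.
exact: (Nv e e0).
Qed.

(** All norms on a finite-dimensional space are equivalent: the minimum of [N]
    on the compact unit sphere is positive. *)
Lemma is_norm_ge : exists2 c : R, 0 < c & forall v, c * `|v| <= N v.
Proof.
pose S := [set v : 'rV[R]_n | `|v| = 1].
have [S0|/set0P S0] := eqVneq S set0.
  exists 1 => // v; have [->|v0] := eqVneq v 0.
    by rewrite normr0 mulr0 is_norm0.
  have : S (`|v|^-1 *: v).
    by rewrite /S/= normrZ normfV normr_id mulVf// normr_eq0.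
  by rewrite S0.
have cS : compact S.
  apply: bounded_closed_compact.
    by exists 1; split => // x x1 v /= ->; exact: ltW.
  rewrite (_ : S = (fun v => `|v|) @^-1` [set 1])//.
  by apply: closed_comp => [v _|]; [exact: norm_continuous|exact: closed_eq].
have [u] := compact_EVT_min S0 cS (continuous_subspaceT is_norm_continuous).
rewrite inE => uS umin; exists (N u).
  by apply: is_norm_gt0; rewrite -normr_eq0 uS oner_neq0.
move=> v; have [->|v0] := eqVneq v 0; first by rewrite normr0 mulr0 is_norm_ge0.
have nv : 0 < `|v| by rewrite normr_gt0.
have := umin (`|v|^-1 *: v).
rewrite inE /S/= normrZ normfV normr_id mulVf ?gt_eqF// => /(_ erefl).
by rewrite is_normZ normfV normr_id mulrC ler_pdivlMr.
Qed.

End NormFacts.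

Section OpNorm.
Variables (R : realType) (a b : nat).
Variables (NV : 'rV[R]_a -> R) (NW : 'rV[R]_b -> R).
Hypotheses (hV : is_norm NV) (hW : is_norm NW).
Implicit Type M : 'M[R]_(a, b).

(** The constant does not depend on [M], which makes the operator norm Lipschitz
    in the entries of the matrix. *)
Lemma mulmx_norm_le : exists2 K : R, 0 < K &
  forall M v, NW (v *m M) <= K * `|M| * NV v.
Proof.
have [c c0 Vc] := is_norm_ge hV; have [K K0 WK] := is_norm_le hW.
exists (K * (a.+1%:R / c)) => [|M v].
  by rewrite mulr_gt0// divr_gt0.
have le_v : `|v| <= c^-1 * NV v by rewrite mulrC ler_pdivlMr// mulrC.
rewrite (le_trans (WK _))// -!mulrA ler_wpM2l ?(ltW K0)//.
have /le_trans : `|v *m M| <= a.+1%:R * (`|v| * `|M|).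
  apply: norm_le_entries => [|i j]; first by rewrite !mulr_ge0.
  rewrite ord1 mxE (le_trans (ler_norm_sum _ _ _))//.
  apply: (@le_trans _ _ (\sum_(k < a) `|v| * `|M|)).
    by apply: ler_sum => k _; rewrite normrM ler_pM// entry_le_norm.
  rewrite sumr_const card_ord -[leLHS]mulr_natl ler_wpM2r ?mulr_ge0//.
  by rewrite ler_nat.
by apply; rewrite ler_wpM2l// [leRHS]mulrCA [leLHS]mulrC ler_wpM2l.
Qed.

Lemma opnorm_has_sup M :
  has_sup [set NW (v *m M) | v in [set v | NV v <= 1]].
Proof.
split; first by exists (NW (0 *m M)), 0 => //=; rewrite is_norm0.
have [K K0 NK] := mulmx_norm_le.
exists (K * `|M|) => _ [v /= v1 <-]; rewrite (le_trans (NK M v))//.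
by rewrite -[leRHS]mulr1 ler_wpM2l// mulr_ge0// ltW.
Qed.

Lemma opnorm_ge0 M : 0 <= opnorm NV NW M.
Proof.
apply: ub_le_sup; first exact: (opnorm_has_sup M).2.
by exists 0; rewrite /= ?mul0mx is_norm0.
Qed.

Lemma opnormP M v : NW (v *m M) <= opnorm NV NW M * NV v.
Proof.
have [->|v0] := eqVneq v 0; first by rewrite mul0mx !is_norm0// mulr0.
have Nv := is_norm_gt0 hV v0.
rewrite -ler_pdivrMr// mulrC.
rewrite (_ : _ * _ = NW (((NV v)^-1 *: v) *m M)); last first.
  by rewrite -scalemxAl is_normZ// ger0_norm// invr_ge0 ltW.
apply: ub_le_sup; first exact: (opnorm_has_sup M).2.
exists ((NV v)^-1 *: v) => //=.
by rewrite is_normZ// gtr0_norm ?invr_gt0// mulVf ?gt_eqF.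
Qed.

Lemma opnorm_le M (K : R) : (forall v, NV v <= 1 -> NW (v *m M) <= K) ->
  opnorm NV NW M <= K.
Proof.
move=> h; apply: ge_sup; first exact: (opnorm_has_sup M).1.
by move=> _ [v /= v1 <-]; exact: h.
Qed.

End OpNorm.

Section LogNorm.
Variables (R : realType) (n : nat) (N : 'rV[R]_n -> R) (A : 'M[R]_n).
Hypotheses (hN : is_norm N) (n0 : (0 < n)%N).

Let Q (h : R) := (opnorm N N (1%:M + h *: A) - 1) / h.

Let mulmx_add1 (v : 'rV[R]_n) (h : R) : v *m (1%:M + h *: A) = v + h *: (v *m A).
Proof. by rewrite mulmxDr mulmx1 scalemxAr. Qed.

(** Convexity of the operator norm: [I + s A] lies on the segment between [I]
    and [I + t A]. *)
Lemma lognorm_quotient_nondecreasing (s t : R) : 0 < s -> s <= t -> Q s <= Q t.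
Proof.
move=> s0 st; have t0 := lt_le_trans s0 st.
rewrite /Q ler_pdivrMr// mulrAC lerBlDr.
apply: opnorm_le => // v v1; rewrite mulmx_add1.
have st0 : 0 <= s / t by rewrite divr_ge0// ltW.
have st1 : 0 <= 1 - s / t by rewrite subr_ge0 ler_pdivrMr// mul1r.
rewrite (_ : v + _ = (1 - s / t) *: v + (s / t) *: (v *m (1%:M + t *: A))).
  rewrite (le_trans (is_normD hN _ _))//= !is_normZ// !ger0_norm//.
  have := opnormP hN hN (1%:M + t *: A) v.
  have := opnorm_ge0 hN hN (1%:M + t *: A).
  set o := opnorm _ _ _ => o0 No.
  have : N (v *m (1%:M + t *: A)) <= o.
    by rewrite (le_trans No)// -[leRHS]mulr1 ler_wpM2l.
  rewrite mulrAC -mulrA.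
  have := ler_wpM2l st1 v1; move=> {}No le1.
  have := ler_wpM2l st0 le1; rewrite -/o.
  by move: No; rewrite !(mulrBl,mulrBr); lra.
rewrite mulmx_add1 scalerDr scalerA addrA -scalerDl subrK scale1r.
by rewrite divfK// gt_eqF.
Qed.

Lemma lognorm_quotient_ge (h : R) : 0 < h -> - opnorm N N A <= Q h.
Proof.
move=> h0; rewrite /Q ler_pdivlMr// mulNr lerBrDl lerBlDr.
pose e : 'rV[R]_n := delta_mx 0 (Ordinal n0).
have e0 : e != 0.
  by apply/eqP => /rowP/(_ (Ordinal n0))/eqP; rewrite !mxE !eqxx/= oner_eq0.
pose v := (N e)^-1 *: e.
have v1 : N v = 1.
  have Ne := is_norm_gt0 hN e0.
  by rewrite is_normZ// gtr0_norm ?invr_gt0// mulVf ?gt_eqF.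
have := opnormP hN hN (1%:M + h *: A) v.
have := opnormP hN hN A v; rewrite v1 !mulr1 mulmx_add1 => NA NI.
have := is_normD hN (v + h *: (v *m A)) (- (h *: (v *m A))).
rewrite addrK v1 is_normN// is_normZ// (gtr0_norm h0) => /le_trans; apply.
by rewrite lerD// mulrC ler_wpM2r// ltW.
Qed.

(** The quotient is monotone and bounded below, so the limit in the definition
    of the logarithmic norm exists and is approached from above. *)
Lemma lognorm_quotient_near (K e : R) : lognorm N A <= K -> 0 < e ->
  \forall h \near 0^'+, forall v,
    N (v + h *: (v *m A)) <= (1 + h * (K + e)) * N v.
Proof.
move=> AK e0.
have cQ : cvg (Q h @[h --> 0^'+]).
  apply: nondecreasing_at_right_is_cvgr.
    apply/nearW => x s t; rewrite !in_itv/= => /andP[s0 _] _.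
    exact: lognorm_quotient_nondecreasing.
  apply/nearW => x; exists (- opnorm N N A) => _ [s /= + <-].
  by rewrite in_itv/= => /andP[s0 _]; exact: lognorm_quotient_ge.
have lQ : lim (Q h @[h --> 0^'+]) < K + e by rewrite (le_lt_trans AK)// ltrDl.
near=> h => v.
have h0 : 0 < h by near: h; exact: nbhs_right_gt.
have : Q h < K + e by near: h; exact: cvgr_lt lQ.
rewrite /Q ltr_pdivrMr// ltrBlDr => /ltW oK.
rewrite -mulmx_add1 (le_trans (opnormP hN hN _ _))//.
rewrite ler_wpM2r//; first exact: is_norm_ge0.
by rewrite (le_trans oK)// addrC mulrC.
Unshelve. all: by end_near. Qed.

End LogNorm.

(** * Jacobian blocks *)

Section JacobianBlocks.
Variables (R : realType) (p m : nat) (n_ : 'I_p -> nat).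
Notation V := 'rV[R]_(\sum_(i < p) n_ i).
Notation Y := 'rV[R]_m.
Variable f : V * Y -> V.
Hypothesis fC1 : C1 f.

Lemma C1_continuous : continuous f.
Proof. by move=> z; apply: differentiable_continuous; exact: fC1.1. Qed.

Lemma partial_differentiable x y : differentiable (fun x' => f (x', y)) x.
Proof.
apply: (@differentiable_comp _ _ _ _ (fun x' => (x', y)) f); last exact: fC1.1.
by apply: differentiable_pair => //; exact: differentiable_cst.
Qed.

Lemma partial_diff x y v : 'd (fun x' => f (x', y)) x v = 'd f (x, y) (v, 0).
Proof.
rewrite -(deriveE _ (partial_differentiable x y)) -(deriveE _ (fC1.1 (x, y))).
apply: (congr1 (fun g : R -> V => lim (g @ 0^'))); apply/funext => k /=.
have -> // : k *: (v, 0) + (x, y) = (k *: v + x, y) :> V * Y.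
by apply: injective_projections => //=; rewrite scaler0 add0r.
Qed.

(** The Jacobian acts on row vectors, so the block of df_i/dx_j multiplies the
    [j]-th block of [v] on the right. *)
Lemma partial_diff_jac_block x y v i :
  submxrow ('d (fun x' => f (x', y)) x v) i =
  \sum_j submxrow v j *m jac_block f i j x y.
Proof.
rewrite -[in LHS](mul_rV_lin1 ('d (fun x' => f (x', y)) x)) -/(jacobian _ _).
rewrite -[in LHS](submxrowK v) -[in LHS](submxblockK (jacobian _ _)).
by rewrite mul_mxrow_mxblock mxrowK.
Qed.

Lemma jac_block_near i j (z : V * Y) (e : R) : 0 < e ->
  \forall z' \near z,
    `|jac_block f i j z.1 z.2 - jac_block f i j z'.1 z'.2| <= e.
Proof.
move=> e0.
have : \forall z' \near z, forall a b,
    `|jac_block f i j z.1 z.2 a b - jac_block f i j z'.1 z'.2 a b| <= e.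
  apply: (@filter_forall _ _ _ _ (nbhs_filter z)) => a.
  apply: (@filter_forall _ _ _ _ (nbhs_filter z)) => b.
  pose v : V := delta_mx 0 (tagnat.Rank j a).
  have E z' : jac_block f i j z'.1 z'.2 a b =
      ('d f z' (v, 0)) 0 (tagnat.Rank i b).
    by rewrite !mxE partial_diff; case: z'.
  have sub z' : `|'d f z (v, 0) - 'd f z' (v, 0)| <= e ->
      `|jac_block f i j z.1 z.2 a b - jac_block f i j z'.1 z'.2 a b| <= e.
    apply: le_trans.
    have := entry_le_norm ('d f z (v, 0) - 'd f z' (v, 0)) 0 (tagnat.Rank i b).
    rewrite mxE [X in _ + X]mxE.
    by move: (f_equal2 (fun u w => `|u - w|) (E z) (E z')) => /= <-.
  have H := @cvgr_dist_le _ _ _ _ (nbhs_filter z) _ _ (fC1.2 (v, 0) z) _ e0.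
  exact: (filterS sub H).
have sub z' : (forall a b,
    `|jac_block f i j z.1 z.2 a b - jac_block f i j z'.1 z'.2 a b| <= e) ->
    `|jac_block f i j z.1 z.2 - jac_block f i j z'.1 z'.2| <= e.
  move=> H; apply: norm_le_entries => [|a b]; first exact: ltW.
  by rewrite mxE [X in _ + X]mxE.
by move=> H; exact: (filterS sub H).
Qed.

End JacobianBlocks.

Lemma is_derive_lincomb (R : realType) (p : nat) (f : 'I_p -> R -> R)
    (df c : 'I_p -> R) (x : R) : (forall j, is_derive x 1 (f j) (df j)) ->
  is_derive x 1 (fun y => \sum_j c j * f j y) (\sum_j c j * df j).
Proof.
move=> fdf; have -> : (fun y => \sum_j c j * f j y) = \sum_j (c j \*: f j).
  by apply/funext => y; rewrite fct_sumE.
by apply: is_derive_sum.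
Qed.

(** Along a line the difference quotient of [g] is the one that defines its
    directional derivative. *)
Lemma is_derive_line (R : realType) (a b : nat) (g : 'rV[R]_a -> 'rV[R]_b)
    (x e : 'rV[R]_a) (th : R) k : differentiable g (x + th *: e) ->
  is_derive th 1 (fun s : R => g (x + s *: e) 0 k) ('d g (x + th *: e) e 0 k).
Proof.
move=> dg; have gd : derivable g (x + th *: e) e by exact: diff_derivable.
have gdk := (derivable_mxP g _ _).1 gd 0 k.
have -> : 'd g (x + th *: e) e 0 k = 'D_e (fun z => g z 0 k) (x + th *: e).
  by rewrite -deriveE// derive_mx// mxE.
have E : (fun h : R =>
      h^-1 *: (g (x + (h *: 1 + th) *: e) 0 k - g (x + th *: e) 0 k)) =
    fun h => h^-1 *: (g (h *: e + (x + th *: e)) 0 k - g (x + th *: e) 0 k).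
  apply/funext => h; congr (_ *: (g _ 0 k - _)).
  by rewrite scalerDl addrCA [h *: 1]mulr1.
by apply: DeriveDef; rewrite /derivable/derive E.
Qed.

(** The logarithmic norm of the diagonal block only enters through the bound on
    I + eta A_ii, so the increment of [f] is kept together with the vector to
    which it is added: the mean value theorem is applied, along a norming
    functional of the left-hand side, to the whole sum. *)
Lemma block_mean_value (R : realType) (p m : nat) (n_ : 'I_p -> nat)
    (N : forall i : 'I_p, 'rV[R]_(n_ i) -> R)
    (f : 'rV[R]_(\sum_(i < p) n_ i) * 'rV[R]_m -> 'rV[R]_(\sum_(i < p) n_ i))
    (i : 'I_p) (x xb : 'rV[R]_(\sum_(i < p) n_ i)) (y : 'rV[R]_m)
    (eta k : R) (c : 'I_p -> R) :
  (forall j, is_norm (N j)) -> C1 f -> 0 <= eta ->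
  (forall th : R, 0 <= th <= 1 -> forall v,
    N i (v + eta *: (v *m jac_block f i i (xb + th *: (x - xb)) y))
      <= (1 + eta * k) * N i v) ->
  (forall (th : R) j, 0 <= th <= 1 -> i != j -> forall v,
    N i (v *m jac_block f i j (xb + th *: (x - xb)) y) <= c j * N j v) ->
  N i (submxrow (x - xb) i + eta *: submxrow (f (x, y) - f (xb, y)) i) <=
  (1 + eta * k) * N i (submxrow (x - xb) i) +
    eta * \sum_(j | j != i) c j * N j (submxrow (x - xb) j).
Proof.
move=> hN fC1 eta0 Aii Aij; set e := x - xb; set w := _ + _.
have [l [lN lw]] := norming_functional w (is_norm_sublinear (hN i)).
pose P := submxrow (1%:M : 'M[R]_(\sum_(i < p) n_ i)) i *m l.
have PE (z : 'rV[R]_(\sum_(i < p) n_ i)) : (z *m P) 0 0 = (submxrow z i *m l) 0 0.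
  by rewrite mulmxA mul_submxrow mulmx1.
pose g x' := f (x', y).
pose u (s : R) := (e *m P) 0 0 * s + \sum_q (eta * P q 0) * g (xb + s *: e) 0 q.
pose du (s : R) := (e *m P) 0 0 +
  \sum_q (eta * P q 0) * 'd g (xb + s *: e) e 0 q.
have ud (s : R) : is_derive s 1 u (du s).
  rewrite /du -[X in X + _]mulr1; apply: is_deriveD.
  apply: is_derive_lincomb => q; apply: is_derive_line.
  exact: partial_differentiable.
have [s] : exists2 s, s \in `[0, 1]%R & u 1 - u 0 = du s * (1 - 0).
  apply: MVT_segment => //.
  apply: continuous_subspaceT => s.
  by apply: differentiable_continuous; apply/derivable1_diffP; case: (ud s).
rewrite in_itv/= subr0 mulr1 => s01 us.
have sumE (z : 'rV[R]_(\sum_(i < p) n_ i)) :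
    \sum_q (eta * P q 0) * z 0 q = (eta *: submxrow z i *m l) 0 0.
  rewrite -scalemxAl mxE -PE mxE mulr_sumr.
  by apply: eq_bigr => q _; rewrite mulrAC mulrA.
have mulD (z1 z2 : 'rV[R]_(n_ i)) :
  ((z1 + z2) *m l) 0 0 = (z1 *m l) 0 0 + (z2 *m l) 0 0 by rewrite mulmxDl mxE.
have <- : u 1 - u 0 = N i w.
  rewrite -lw /w mulD -PE submxrowB scalerBr mulD -scalerN -submxrowN -!sumE /u.
  rewrite scale0r scale1r addr0 mulr0 add0r mulr1 -addrA; congr (_ + _).
  rewrite /e subrKC -sumrN; congr (_ + _).
  by apply: eq_bigr => q _; rewrite [X in _ = _ * X]mxE mulrN.
have -> : u 1 - u 0 =
    ((submxrow e i + eta *: submxrow ('d g (xb + s *: e) e) i) *m l) 0 0.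
  by rewrite us /du mulD -PE sumE.
rewrite (le_trans (lN _))// partial_diff_jac_block// (bigD1 i)//= scalerDr addrA.
rewrite (le_trans (is_normD (hN i) _ _))// lerD//; first exact: Aii.
rewrite is_normZ// ger0_norm// ler_wpM2l//.
elim/big_rec2: _ => [|j z1 z2 ji IH]; first by rewrite is_norm0.
rewrite (le_trans (is_normD (hN i) _ _))// lerD//.
by apply: Aij; rewrite // eq_sym.
Qed.

(** * Uniform estimates *)

(** A bound on the logarithmic norms bounds [I + h A] only for [h] small
    depending on [A]; the operator norm being Lipschitz, the same [h] works up
    to [e] for all matrices near [A], and compactness makes it uniform. *)
Lemma lognorm_quotient_uniform (R : realType) (n : nat) (N : 'rV[R]_n -> R)
    (T : topologicalType) (A : T -> 'M[R]_n) (D Q : set T) (K e : R) :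
  is_norm N -> (0 < n)%N -> compact Q -> D `<=` Q ->
  (forall z d, 0 < d -> \forall z' \near z, `|A z - A z'| <= d) ->
  (forall z, D z -> lognorm N (A z) <= K) -> 0 < e ->
  \forall h \near 0^'+, forall z, D z -> forall v,
    N (v + h *: (v *m A z)) <= (1 + h * (K + e)) * N v.
Proof.
move=> hN n0 cQ DQ Acont DK e0.
have [B B0 NB] := mulmx_norm_le hN hN.
pose P (h : R) z := D z -> forall v,
  N (v + h *: (v *m A z)) <= (1 + h * (K + e)) * N v.
suff : \forall h \near 0^'+, Q `<=` P h.
  by apply: filterS => h QP z Dz; exact: QP (DQ _ Dz) Dz.
apply: (compact_near_coveringP Q).1 => // z Qz.
(* [z0] and [z'] are both within [d] of [z], which costs [e / 2]; the other
   [e / 2] is spent on the limit at [z0]. *)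
pose d := e / 4 / B.
have d0 : 0 < d by rewrite !divr_gt0.
pose U := [set z' | `|A z - A z'| <= d].
have Uz : nbhs z U by exact: Acont.
have [[z0 [Dz0 Uz0]]|noD] := pselect (exists z0, D z0 /\ U z0); last first.
  exists (U, setT) => /=; first by split=> //; exact: filterT.
  by move=> [z' h]/= [Uz' _] Dz'; exfalso; apply: noD; exists z'.
have e2 : 0 < e / 2 by rewrite divr_gt0.
have near0 := lognorm_quotient_near hN n0 (DK _ Dz0) e2.
exists (U, [set h : R | 0 < h /\ forall v,
    N (v + h *: (v *m A z0)) <= (1 + h * (K + e / 2)) * N v]) => /=.
  by split=> //; apply: filterI => //; exact: nbhs_right_gt.
move=> [z' h]/= [Uz' [h0 hz0]] _ v.
have -> : v + h *: (v *m A z') =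
    (v + h *: (v *m A z0)) + h *: (v *m (A z' - A z0)).
  by rewrite mulmxBr scalerBr -addrA subrKC.
rewrite (le_trans (is_normD hN _ _))//.
rewrite (_ : (1 + h * (K + e)) * N v =
  (1 + h * (K + e / 2)) * N v + h * (e / 2 * N v)); last by field.
rewrite lerD// is_normZ// gtr0_norm// ler_wpM2l ?(ltW h0)//.
rewrite (le_trans (NB _ _))// ler_wpM2r ?is_norm_ge0// -ler_pdivlMl//.
rewrite (_ : A z' - A z0 = (A z - A z0) - (A z - A z')); last first.
  by rewrite opprB [RHS]addrC subrKA.
rewrite (le_trans (ler_normB _ _))// (le_trans (lerD Uz0 Uz'))//.
by rewrite /d le_eqVlt; apply/orP; left; apply/eqP; field; rewrite gt_eqF.
Qed.

(** Compactness of [Q] turns continuity of [f] at each point (a, y) into a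
    neighbourhood of [a] that serves all [y] in [Q]. *)
Lemma uniform_near_compact (R : realType) (V Y W : normedModType R)
    (f : V * Y -> W) (Q : set Y) (T : Type) (F : set_system T) (FF : Filter F)
    (x : T -> V) (a : V) (e : R) : continuous f -> compact Q ->
  (forall d : R, 0 < d -> \forall u \near F, `|a - x u| <= d) -> 0 < e ->
  \forall u \near F, forall y, Q y -> `|f (a, y) - f (x u, y)| <= e.
Proof.
move=> fc cQ xa e0.
apply: (compact_near_coveringP Q).1 => // y Qy.
have e2 : 0 < e / 2 by rewrite divr_gt0.
have [/= [U1 U2] [U1a U2y] U12] :=
  @cvgr_dist_le _ _ _ _ (nbhs_filter (a, y)) _ _ (fc (a, y)) _ e2.
have [r /= r0 rU] := (nbhs_normP _ _).1 U1a.
exists (U2, [set u | U1 (x u)]) => /=.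
  split=> //; apply: (filterS _ (xa (r / 2) _)) => [u xu|]; last by rewrite divr_gt0.
  by apply: rU => /=; rewrite (le_lt_trans xu)// ltr_pdivrMr// ltr_pMr// ltr1n.
move=> [y' u]/= [y'U uU].
have a_y' := U12 (a, y') (conj (nbhs_singleton U1a) y'U).
have x_y' := U12 (x u, y') (conj uU y'U).
have -> : f (a, y') - f (x u, y') =
    (f (a, y) - f (x u, y')) - (f (a, y) - f (a, y')).
  by rewrite opprB [RHS]addrC subrKA.
rewrite (le_trans (ler_normB _ _))// (le_trans (lerD x_y' a_y'))//.
by rewrite -splitr.
Qed.

Lemma absolutely_continuous_uniform (R : realType) (n : nat) (a b : R)
    (x : R -> 'rV[R]_n) (e : R) : absolutely_continuous a b x -> 0 < e ->
  exists2 d : R, 0 < d & forall u v, a <= u -> u <= v -> v <= b ->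
    v - u < d -> `|x v - x u| < e.
Proof.
move=> ac e0; have [d d0 acd] := ac e e0; exists d => // u v au uv vb uvd.
have := acd 1%N (fun=> u) (fun=> v); rewrite !big_ord1; apply=> //.
by move=> i j _ _ _; rewrite !ord1.
Qed.

(** * A comparison principle for Dini differential inequalities *)

Lemma at_right0_segment (R : realType) (P : R -> Prop) :
  (\forall h \near 0^'+, P h) ->
  exists2 d : R, 0 < d & forall h, 0 < h -> h <= d -> P h.
Proof.
move=> /nbhs_ballP[e /= e0 eP]; exists (e / 2) => [|h h0 he].
  by rewrite divr_gt0.
apply: eP => //; rewrite /ball/= sub0r normrN gtr0_norm//.
by rewrite (le_lt_trans he)// ltr_pdivrMr// ltr_pMr// ltr1n.
Qed.

(** The supremum of the times up to which [P] holds is reached by closure on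
    the left, and would be passed by extension to the right. *)
Lemma real_induction (R : realType) (a b : R) (P : R -> Prop) :
  P a ->
  (forall s, a < s -> s <= b -> (forall u, a <= u -> u < s -> P u) -> P s) ->
  (forall s, a <= s -> s < b -> (forall u, a <= u -> u <= s -> P u) ->
    \forall h \near 0^'+, P (s + h)) ->
  forall t, a <= t -> t <= b -> P t.
Proof.
move=> Pa Pl Pr t at_ tb; have ab := le_trans at_ tb.
pose S := [set s : R | s <= b /\ forall u, a <= u -> u <= s -> P u].
have Sa : S a by split=> // u au ua; rewrite (le_anti (_ : u <= a <= u)) ?ua.
have hS : has_sup S by split; [exists a|exists b => s []].
set s := sup S.
have as_ : a <= s by apply: ub_le_sup => //; exact: hS.2.
have sb : s <= b by apply: ge_sup; [exists a|move=> u []].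
have Plt u : a <= u -> u < s -> P u.
  by move=> au /(sup_gt hS.1)[v [_ Sv]] uv; apply: Sv => //; exact: ltW.
have Ple u : a <= u -> u <= s -> P u.
  move=> au; rewrite le_eqVlt => /predU1P[->|]; last exact: Plt.
  move: as_; rewrite le_eqVlt => /predU1P[<-//|as_]; exact: Pl.
have [sltb|bs] := ltP s b; last by apply: Ple => //; exact: le_trans bs.
have [d d0 dP] := at_right0_segment (Pr s as_ sltb Ple).
pose e := Num.min d (b - s).
have e0 : 0 < e by rewrite lt_min d0 subr_gt0.
suff /(ub_le_sup hS.2) : S (s + e) by rewrite leNgt ltrDl e0.
split=> [|u au]; first by rewrite -lerBrDl ge_min lexx orbT.
have [us _|su use] := leP u s; first exact: Ple.
rewrite -(subrKC s u); apply: dP; first by rewrite subr_gt0.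
by rewrite lerBlDl (le_trans use)// lerD2l ge_min lexx.
Qed.

(** The barrier [e * expR (L * (t - a))] dominates [d]: where [d i] touches the
    barrier from below, the other [d j] lie below it, so the nonnegativity of
    the off-diagonal entries of [J] bounds the growth of [d i] by that of the
    barrier, as soon as [L] exceeds the row sums of the moduli. *)
Lemma dini_nonpos (R : realType) (p : nat) (a b : R) (J : 'M[R]_p)
    (d : 'I_p -> R -> R) :
  (forall i j, i != j -> 0 <= J i j) ->
  (forall i, {within `[a, b], continuous (d i)}) ->
  (forall i, d i a <= 0) ->
  (forall s i e, a <= s -> s < b -> 0 < e ->
    \forall h \near 0^'+,
      d i (s + h) <= d i s + h * (\sum_j J i j * d j s + e)) ->
  forall t i, a <= t -> t <= b -> d i t <= 0.
Proof.
move=> J0 dc da dini t i at_ tb.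
have [ab|ba] := ltP a b; last first.
  by rewrite (_ : t = a)//; apply/eqP; rewrite eq_le at_ (le_trans tb).
have dl j s : a < s -> s <= b -> d j x @[x --> s^'-] --> d j s.
  have [c _ cb] := (continuous_within_itvP _ ab).1 (dc j).
  move=> as_; rewrite le_eqVlt => /predU1P[->//|sb].
  by apply: cvg_at_left_filter; apply: c; rewrite in_itv/= as_.
have dr j s : a <= s -> s < b -> d j x @[x --> s^'+] --> d j s.
  have [c ca _] := (continuous_within_itvP _ ab).1 (dc j).
  rewrite le_eqVlt => /predU1P[<-//|as_] sb.
  by apply: cvg_at_right_filter; apply: c; rewrite in_itv/= as_.
pose L : R := 1 + \sum_i \sum_j `|J i j|.
have LJ k : \sum_j `|J k j| + 1 <= L.
  rewrite addrC lerD2l [leRHS](bigD1 k)//= lerDl sumr_ge0// => l _.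
  by rewrite sumr_ge0.
(* A positive value of [d i t] would lie above a small enough barrier. *)
suff main (e : R) : 0 < e -> forall s, a <= s -> s <= b ->
    forall j, d j s <= e * expR (L * (s - a)).
  rewrite leNgt; apply/negP => dt.
  have E0 := expR_gt0 (L * (t - a)).
  have e0 : 0 < d i t / 2 / expR (L * (t - a)) by rewrite !divr_gt0.
  by have := main _ e0 t at_ tb i; rewrite divfK ?gt_eqF//; lra.
move=> e0; pose g s := e * expR (L * (s - a)).
have g0 s : 0 < g s by rewrite mulr_gt0// expR_gt0.
have gD (s h : R) : g s + h * (L * g s) <= g (s + h).
  rewrite {3}/g addrAC (mulrDr L) expRD [leRHS]mulrA -/(g s).
  rewrite (_ : _ + _ = g s * (1 + L * h)); last by ring.
  by rewrite ler_pM2l// expR_ge1Dx.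
apply: real_induction => [j|s as_ sb Ps j|s as_ sb Ps].
- by rewrite (le_trans (da j))// ltW// g0.
- have gc : g x @[x --> s^'-] --> g s.
    apply: cvg_at_left_filter; apply: cvgM; first exact: cvg_cst.
    apply: continuous_comp; last exact: continuous_expR.
    apply: cvgM; first exact: cvg_cst.
    by apply: cvgB; [exact: cvg_id|exact: cvg_cst].
  apply: (ler_cvg_to (dl j s as_ sb) gc); near=> u.
  apply: Ps; last by near: u; exact: nbhs_left_lt.
  by near: u; exact: nbhs_left_ge.
- apply: filter_forall => j.
  have : d j s <= g s by exact: Ps.
  rewrite le_eqVlt => /predU1P[djs|djs].
    have := dini s j (g s) as_ sb (g0 s).
    apply: filter_app; near=> h => /le_trans; apply.
    have h0 : 0 < h by near: h; exact: nbhs_right_gt.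
    rewrite djs (le_trans _ (gD s h))// lerD2l ler_pM2l//.
    rewrite (le_trans _ (ler_wpM2r (ltW (g0 s)) (LJ j)))//.
    rewrite mulrDl mul1r lerD2r mulr_suml ler_sum// => k _.
    have [<-|jk] := eqVneq j k; first by rewrite djs ler_pM2r// ler_norm.
    by rewrite ger0_norm ?J0// ler_wpM2l ?J0// Ps.
  have := dr j s as_ sb => /cvgr_lt/(_ _ djs)/nbhs_right0P.
  apply: filter_app; near=> h => /ltW/le_trans; apply.
  have h0 : 0 < h by near: h; exact: nbhs_right_gt.
  rewrite (le_trans _ (gD s h))// lerDl mulr_ge0 ?mulr_ge0// ?ltW//.
  by rewrite (lt_le_trans _ (LJ j))// ltr_wpDl// sumr_ge0.
Unshelve. all: by end_near. Qed.

(** * The matrix exponential as an entire function *)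

(** A growth condition stable under differentiation that makes the power series
    converge everywhere. *)
Definition factorial_bound (R : realType) (c : R^nat) : Prop :=
  exists M B : R, forall k, `|c k| <= M * (B ^+ k / k`!%:R).

Section EntireSeries.
Variables (R : realType) (c : R^nat).

Lemma entire_at0 : limn (pseries c 0) = c 0%N.
Proof.
apply: cvg_lim => //; rewrite -cvg_shiftS/=.
rewrite (_ : (fun n => _) = fun=> c 0%N); first exact: cvg_cst.
apply/funext => n; rewrite /pseries/series/= big_nat_recl//= expr0 mulr1.
by rewrite big1 ?addr0// => i _; rewrite expr0n/= mulr0.
Qed.

Hypothesis cb : factorial_bound c.

Lemma entire_cvg (x : R) : cvgn (pseries c x).
Proof.
have [M [B cMB]] := cb.
apply: normed_cvg.
apply: (series_le_cvg (v_ := fun k => `|M| * exp_coeff (`|B| * `|x|) k)) => [k|k|k|].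
- exact: normr_ge0.
- by rewrite mulr_ge0// exp_coeff_ge0// mulr_ge0.
- rewrite /= normrM normrX.
  rewrite [leRHS](_ : _ = `|M| * (`|B| ^+ k / k`!%:R) * `|x| ^+ k); last first.
    by rewrite /exp_coeff/= exprMn -!mulrA; congr (_ * (_ * _)); rewrite mulrC.
  rewrite ler_wpM2r ?exprn_ge0// (le_trans (cMB k))// (le_trans (ler_norm _))//.
  by rewrite normrM normrM normrX normfV normr_nat.
- exact: (@is_cvg_seriesZ _ _ `|M| (is_cvg_series_exp_coeff (`|B| * `|x|))).
Qed.

Lemma entire_diffs_bound : factorial_bound (pseries_diffs c).
Proof.
have [M [B cMB]] := cb; exists (M * B), B => k.
rewrite /pseries_diffs normrM normr_nat.
rewrite (_ : M * B * _ = k.+1%:R * (M * (B ^+ k.+1 / k.+1`!%:R))).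
  by rewrite ler_wpM2l.
rewrite factS natrM exprS; field.
by rewrite nat1r !pnatr_eq0 -lt0n fact_gt0.
Qed.

End EntireSeries.

Lemma entire_is_derive (R : realType) (c : R^nat) (x : R) : factorial_bound c ->
  is_derive x 1 (fun y => limn (pseries c y)) (limn (pseries (pseries_diffs c) x)).
Proof.
move=> cb; apply: (@pseries_snd_diffs _ _ (`|x| + 1)).
- exact: entire_cvg.
- exact/entire_cvg/entire_diffs_bound.
- exact/entire_cvg/entire_diffs_bound/entire_diffs_bound.
- by rewrite [ltRHS]ger0_norm ?ltrDl// addr_ge0.
Qed.

Section MatrixExponential.
Variables (R : realType) (p : nat) (J : 'M[R]_p).

Definition exp_entry_coeff i j : R^nat := fun k => (J ^+ k) i j / k`!%:R.

(** The coefficients of the entries of the primitive of [x |-> expmx (x *: J)]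
    that vanishes at [0]. *)
Definition primexp_entry_coeff i j : R^nat :=
  fun k => if k is k'.+1 then (J ^+ k') i j / k`!%:R else 0.

Definition exp_entry i j (x : R) := limn (pseries (exp_entry_coeff i j) x).

Definition primexp_entry i j (x : R) :=
  limn (pseries (primexp_entry_coeff i j) x).

Lemma mx_expS_entry k i j : (J ^+ k.+1) i j = \sum_l J i l * (J ^+ k) l j.
Proof. by rewrite exprS mxE. Qed.

Lemma mx_exp_entry_le : exists2 B : R, 1 <= B &
  forall k i j, `|(J ^+ k) i j| <= B ^+ k.
Proof.
pose B := 1 + \sum_i \sum_j `|J i j|.
have B1 : 1 <= B by rewrite lerDl sumr_ge0// => i _; rewrite sumr_ge0.
exists B => //; elim=> [|k IH] i j.
  by rewrite !expr0 !mxE; case: eqP => _; rewrite ?normr1 ?normr0.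
rewrite mx_expS_entry exprS (le_trans (ler_norm_sum _ _ _))//.
apply: (@le_trans _ _ (\sum_l `|J i l| * B ^+ k)).
  by apply: ler_sum => l _; rewrite normrM ler_wpM2l.
rewrite -mulr_suml ler_wpM2r ?exprn_ge0 ?(le_trans ler01)//.
rewrite /B [leRHS](_ : _ = \sum_l `|J i l| +
    (1 + \sum_(k | k != i) \sum_l `|J k l|)); last by rewrite (bigD1 i)//= addrCA.
rewrite lerDl addr_ge0// sumr_ge0// => l _.
by rewrite sumr_ge0.
Qed.

Lemma exp_entry_bound i j : factorial_bound (exp_entry_coeff i j).
Proof.
have [B B1 JB] := mx_exp_entry_le; exists 1, B => k.
by rewrite normrM normfV normr_nat mul1r ler_wpM2r.
Qed.

Lemma primexp_entry_bound i j : factorial_bound (primexp_entry_coeff i j).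
Proof.
have [B B1 JB] := mx_exp_entry_le; exists 1, B => -[|k]; rewrite mul1r.
  by rewrite normr0 divr_ge0// exprn_ge0// (le_trans ler01).
rewrite normrM normfV normr_nat ler_wpM2r// (le_trans (JB _ _ _))//.
by rewrite exprS ler_peMl// exprn_ge0// (le_trans ler01).
Qed.

Lemma exp_entry_diffs i j k :
  pseries_diffs (exp_entry_coeff i j) k = \sum_l J i l * exp_entry_coeff l j k.
Proof.
rewrite /pseries_diffs /exp_entry_coeff mx_expS_entry.
under [RHS]eq_bigr do rewrite mulrA; rewrite -mulr_suml.
rewrite factS natrM; field.
by rewrite nat1r !pnatr_eq0 -lt0n fact_gt0.
Qed.

Lemma primexp_entry_diffs i j :
  pseries_diffs (primexp_entry_coeff i j) = exp_entry_coeff i j.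
Proof.
apply/funext => k; rewrite /pseries_diffs /exp_entry_coeff /primexp_entry_coeff.
rewrite factS natrM; field.
by rewrite nat1r !pnatr_eq0 -lt0n fact_gt0.
Qed.

Lemma exp_entry_is_derive i j (x : R) :
  is_derive x 1 (exp_entry i j) (\sum_l J i l * exp_entry l j x).
Proof.
have := entire_is_derive x (exp_entry_bound i j).
rewrite [X in is_derive _ _ _ X -> _](_ : _ = \sum_l J i l * exp_entry l j x)//.
apply: cvg_lim => //.
have -> : pseries (pseries_diffs (exp_entry_coeff i j)) x =
    fun n => \sum_l J i l * pseries (exp_entry_coeff l j) x n.
  apply/funext => n; rewrite /pseries/series/=.
  under [RHS]eq_bigr do rewrite mulr_sumr.
  rewrite exchange_big/=; apply: eq_bigr => k _.
  by rewrite exp_entry_diffs mulr_suml; apply: eq_bigr => l _; rewrite mulrA.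
apply: (@cvg_big R _ _ _ _ add_continuous) => l _.
by apply: cvgM; [exact: cvg_cst|exact/entire_cvg/exp_entry_bound].
Qed.

Lemma primexp_entry_is_derive i j x :
  is_derive (x : R) 1 (primexp_entry i j) (exp_entry i j x).
Proof.
have := entire_is_derive x (primexp_entry_bound i j).
by rewrite primexp_entry_diffs.
Qed.

Lemma exp_entry0 i j : exp_entry i j 0 = (i == j)%:R.
Proof.
by rewrite /exp_entry entire_at0 /exp_entry_coeff expr0 mxE fact0 divr1.
Qed.

Lemma primexp_entry0 i j : primexp_entry i j 0 = 0.
Proof. by rewrite /primexp_entry entire_at0. Qed.

(** Both sides have the same derivative and the same value at [0]. *)
Lemma exp_entryE i j x :
  exp_entry i j x = (i == j)%:R + \sum_l J i l * primexp_entry l j x.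
Proof.
apply/eqP; rewrite -subr_eq; apply/eqP.
have -> : (i == j)%:R =
    exp_entry i j 0 - \sum_l J i l * primexp_entry l j 0.
  rewrite exp_entry0 big1 ?subr0// => l _.
  by rewrite primexp_entry0 mulr0.
pose D y := exp_entry i j y - \sum_l J i l * primexp_entry l j y.
apply: (@is_derive_0_is_cst _ D x 0) => y.
rewrite -(subrr (\sum_l J i l * exp_entry l j y)).
apply: is_deriveB; first exact: exp_entry_is_derive.
by apply: is_derive_lincomb => l; exact: primexp_entry_is_derive.
Qed.

Lemma exprZmx (x : R) k : (x *: J) ^+ k = x ^+ k *: J ^+ k.
Proof.
elim: k => [|k IH]; first by rewrite !expr0 scale1r.
by rewrite !exprS IH -[LHS]scalemxAl -[X in x *: X]scalemxAr scalerA.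
Qed.

Lemma expmxE x i j : expmx (x *: J) i j = exp_entry i j x.
Proof.
pose E : 'M[R]_p := \matrix_(i, j) exp_entry i j x.
suff -> : expmx (x *: J) = E by rewrite mxE.
rewrite /expmx; apply: cvg_lim; first exact: norm_hausdorff.
apply/cvgrPdist_le => e e0.
have : \forall n \near \oo, forall k l,
    `|exp_entry k l x - pseries (exp_entry_coeff k l) x n| <= e.
  apply: filter_forall => k; apply: filter_forall => l.
  have kl := entire_cvg (exp_entry_bound k l) (x := x).
  exact: (@cvgr_dist_le _ R^o _ _ _ _ _ kl _ e0).
apply: filterS => n nE.
apply: norm_le_entries => [|k l]; first exact: ltW.
have -> : (E - series (fun k => k`!%:R^-1 *: (x *: J) ^+ k) n) k l =
    exp_entry k l x - pseries (exp_entry_coeff k l) x n.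
  rewrite !mxE summxE; congr (_ - _); apply: eq_bigr => m _.
  by rewrite exprZmx !mxE /exp_entry_coeff/=; ring.
exact: nE.
Qed.

End MatrixExponential.

Section AffineFlow.
Variables (R : realType) (p : nat) (J : 'M[R]_p) (w0 C : 'cV[R]_p).

(** The solution of z' = J z + C, z(0) = w0, in which the variation of
    constants integral is written as a power series. *)
Definition affine_flow i (x : R) : R :=
  \sum_j w0 j 0 * exp_entry J i j x + \sum_j C j 0 * primexp_entry J i j x.

Lemma affine_flow0 i : affine_flow i 0 = w0 i 0.
Proof.
rewrite /affine_flow [X in _ + X]big1 => [|j _].
  rewrite (bigD1 i)//= exp_entry0 eqxx mulr1 addr0 big1 ?addr0// => j ji.
  by rewrite exp_entry0 eq_sym (negbTE ji) mulr0.
by rewrite primexp_entry0 mulr0.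
Qed.

Lemma affine_flow_is_derive i (x : R) :
  is_derive x 1 (affine_flow i) (\sum_j J i j * affine_flow j x + C i 0).
Proof.
rewrite [X in is_derive _ _ _ X](_ : _ =
    \sum_j w0 j 0 * (\sum_l J i l * exp_entry J l j x) +
    \sum_j C j 0 * exp_entry J i j x).
  apply: is_deriveD; apply: is_derive_lincomb => j.
    exact: exp_entry_is_derive.
  exact: primexp_entry_is_derive.
under eq_bigr do rewrite mulrDr; rewrite big_split/= -addrA; congr (_ + _).
  under eq_bigr do rewrite mulr_sumr; rewrite exchange_big/=.
  by apply: eq_bigr => j _; rewrite mulr_sumr; apply: eq_bigr => l _; rewrite mulrCA.
under [RHS]eq_bigr do rewrite exp_entryE mulrDr.
rewrite big_split/= addrC; congr (_ + _).
  rewrite (bigD1 i)//= eqxx mulr1 big1 ?addr0// => j ji.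
  by rewrite eq_sym (negbTE ji) mulr0.
under eq_bigr do rewrite mulr_sumr; rewrite exchange_big/=.
by apply: eq_bigr => j _; rewrite mulr_sumr; apply: eq_bigr => l _; rewrite mulrCA.
Qed.

(** The integrand s |-> e^((t-s)J) C is the derivative of s |-> - Phi(t - s) C,
    where Phi is the primitive of x |-> e^(xJ) that vanishes at 0. *)
Lemma affine_flowE (a t : R) i : a <= t ->
  affine_flow i (t - a) = (expmx ((t - a) *: J) *m w0) i 0 +
    (int_mx (@lebesgue_measure R) `[a, t]
      (fun s => expmx ((t - s) *: J) *m C)) i 0.
Proof.
move=> at_; rewrite mxE /affine_flow; congr (_ + _).
  by apply: eq_bigr => j _; rewrite expmxE mulrC.
rewrite mxE; apply/esym.
have -> : (fun s : R => (expmx ((t - s) *: J) *m C) i 0) =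
    fun s => \sum_j C j 0 * exp_entry J i j (t - s).
  apply/funext => s; rewrite mxE.
  by apply: eq_bigr => j _; rewrite expmxE mulrC.
move: at_; rewrite le_eqVlt => /predU1P[<-|at_].
  rewrite set_itv1 Rintegral_set1 subrr big1// => j _.
  by rewrite primexp_entry0 mulr0.
pose G (s : R) := \sum_j - C j 0 * primexp_entry J i j (t - s).
pose g (s : R) := \sum_j C j 0 * exp_entry J i j (t - s).
have dsub (s : R) : is_derive s 1 (fun s : R => t - s) (-1).
  rewrite -[X in is_derive _ _ _ X]add0r.
  exact: is_deriveB.
have dG (s : R) : is_derive s 1 G (g s).
  rewrite [g s](_ : _ = \sum_j - C j 0 * (exp_entry J i j (t - s) * -1)).
    apply: is_derive_lincomb => j.
    exact: (is_derive1_comp (f := primexp_entry J i j) (primexp_entry_is_derive _ _ _ _)).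
  by apply: eq_bigr => j _; rewrite mulrN1 mulrNN.
have dg (s : R) : exists l, is_derive s 1 g l.
  eexists; apply: is_derive_lincomb => j.
  exact: (is_derive1_comp (f := exp_entry J i j) (exp_entry_is_derive _ _ _ _)).
have cont (f : R -> R) (s : R) :
    (exists l, is_derive s 1 f l) -> {for s, continuous f}.
  by move=> [l [df _]]; apply: differentiable_continuous; exact/derivable1_diffP.
have cG (s : R) : {for s, continuous G} by apply: cont; exists (g s).
rewrite /Rintegral (@continuous_FTC2 _ g G)//=.
- rewrite /G subrr.
  rewrite [X in X - _]big1 ?sub0r => [|j _]; last by rewrite primexp_entry0 mulr0.
  by rewrite -sumrN; apply: eq_bigr => j _; rewrite mulNr opprK.
- by apply: continuous_subspaceT => s; exact: cont.
- split.
  + by move=> s _; case: (dG s).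
  + by apply: cvg_at_right_filter; exact: cG.
  + by apply: cvg_at_left_filter; exact: cG.
- by move=> s _; rewrite derive1E; apply: derive_val.
Qed.

End AffineFlow.

(** * Increments of weak solutions *)

Section RintegralSum.
Context d (T : measurableType d) (R : realType).
Variables (mu : {measure set T -> \bar R}) (D : set T) (mD : measurable D).

Lemma integrable_lincomb (n : nat) (g : 'I_n -> T -> R) (l : 'I_n -> R) :
  (forall k, mu.-integrable D (EFin \o g k)) ->
  mu.-integrable D (EFin \o fun x => \sum_k g k x * l k).
Proof.
move=> gi; rewrite (_ : _ \o _ = fun x => (\sum_k (g k x * l k)%:E)%E).
  apply: integrable_sum => // k _.
  rewrite (_ : (fun _ => _) = fun x => ((g k x)%:E * (l k)%:E)%E)//.
  exact: (integrableZr mD _ (gi k)).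
by apply/funext => x; rewrite /= sumEFin.
Qed.

Lemma Rintegral_lincomb (n : nat) (g : 'I_n -> T -> R) (l : 'I_n -> R) :
  (forall k, mu.-integrable D (EFin \o g k)) ->
  \int[mu]_(x in D) (\sum_k g k x * l k) =
  \sum_k (\int[mu]_(x in D) g k x) * l k.
Proof.
move=> gi.
have gli k : mu.-integrable D (EFin \o fun x => g k x * l k).
  rewrite (_ : _ \o _ = fun x => ((g k x)%:E * (l k)%:E)%E)//.
  exact: (integrableZr mD _ (gi k)).
rewrite /Rintegral; under eq_integral do rewrite -sumEFin.
rewrite integral_sum// -sum_fine => [|k _]; last by apply: integrable_fin_num => //; exact: gli.
by apply: eq_bigr => k _; exact: RintegralZr.
Qed.

End RintegralSum.

Section WeakSolutionIncrement.
Variable R : realType.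
Notation mu := (@completed_lebesgue_measure R).

Lemma measurable_itv_lebesgueR (i : interval R) :
  measurable ([set` i] : set (lebesgueR R)).
Proof. by apply: sub_caratheodory; exact: measurable_itv. Qed.

Lemma Rintegral_increment_le (g : R -> R) (a b s t K : R) :
  mu.-integrable `[a, b] (EFin \o g) -> a <= s -> s <= t -> t <= b ->
  (forall u, s < u -> u <= t -> g u <= K) ->
  (\int[mu]_(u in `[a, t]) g u) - (\int[mu]_(u in `[a, s]) g u) <= K * (t - s).
Proof.
move=> gi as_ st tb gK.
have mi := measurable_itv_lebesgueR.
have sub (i : interval R) : [set` i] `<=` `[a, b]%classic ->
    mu.-integrable [set` i] (EFin \o g).
  by move=> ?; apply: integrableS gi => //; exact: mi.
have split_at : `[a, t]%classic = `[a, s] `|` `]s, t] :> set R.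
  by rewrite -(@itv_bndbnd_setU _ _ _ (BRight s))// bnd_simp.
have ist : mu.-integrable `]s, t] (EFin \o g).
  apply: sub => u/=; rewrite !in_itv/= => /andP[su ut].
  by rewrite (ltW (le_lt_trans as_ su)) (le_trans ut).
have iat : mu.-integrable (`[a, s]%classic `|` `]s, t]%classic) (EFin \o g).
  rewrite -split_at; apply: sub => u/=; rewrite !in_itv/= => /andP[-> ut].
  by rewrite (le_trans ut).
have dis : [disjoint `[a, s]%classic & `]s, t]%classic].
  apply/disj_setPRL => u/=; rewrite !in_itv/= => /andP[su _]/andP[_].
  by rewrite leNgt su.
rewrite split_at (Rintegral_setU (mi `[a, s]%R) (mi `]s, t]%R) iat dis).
rewrite addrAC subrr add0r.
have muE : mu (`]s, t]%classic : set R) = (t - s)%:E.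
  rewrite (_ : mu _ = @lebesgue_measure R `]s, t]%classic)//.
  rewrite lebesgue_measure_itv/= lte_fin.
  by move: st; rewrite le_eqVlt => /predU1P[->|->]//; rewrite ltxx subrr.
have <- : \int[mu]_(_ in `]s, t]) K = K * (t - s).
  rewrite Rintegral_cst; last by apply: sub_caratheodory; exact: measurable_itv.
  by congr (K * _); exact: (congr1 fine muE).
apply: (le_Rintegral (mi `]s, t]%R)) => //.
  apply/integrableP; split; first exact: measurable_cst.
  rewrite integral_cst; last by apply: sub_caratheodory; exact: measurable_itv.
  by rewrite -[X in (_ * X)%E]/(mu (`]s, t]%classic : set R)) muE ltry.
by move=> u/=; rewrite in_itv/= => /andP[]; exact: gK.
Qed.

(** A linear functional turns the vector integral of the difference of the
    right-hand sides into a scalar one, for which a pointwise upper bound is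
    enough. *)
Lemma weak_solution_increment_le (n m : nat)
    (f : 'rV[R]_n * 'rV[R]_m -> 'rV[R]_n) (y1 y2 : R -> 'rV[R]_m)
    (t0 h : R) (a1 a2 : 'rV[R]_n) (x1 x2 : R -> 'rV[R]_n)
    (l : 'cV[R]_n) (s t K : R) :
  weak_solution f y1 t0 h a1 x1 -> weak_solution f y2 t0 h a2 x2 ->
  t0 <= s -> s <= t -> t <= t0 + h ->
  (forall u, s < u -> u <= t ->
    ((f (x1 u, y1 u) - f (x2 u, y2 u)) *m l) 0 0 <= K) ->
  (((x1 t - x2 t) - (x1 s - x2 s)) *m l) 0 0 <= K * (t - s).
Proof.
move=> [_ i1 x1E] [_ i2 x2E] t0s st th fK.
have gi k : mu.-integrable `[t0, t0 + h] (EFin \o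
    (fun u => f (x1 u, y1 u) 0 k - f (x2 u, y2 u) 0 k)).
  rewrite (_ : _ \o _ =
    fun u => ((f (x1 u, y1 u) 0 k)%:E - (f (x2 u, y2 u) 0 k)%:E)%E)//.
  by apply: integrableB; [exact: measurable_itv_lebesgueR|exact: i1|exact: i2].
have xE u : t0 <= u -> u <= t0 + h -> ((x1 u - x2 u) *m l) 0 0 =
    ((a1 - a2) *m l) 0 0 + \int[mu]_(v in `[t0, u])
      (\sum_k (f (x1 v, y1 v) 0 k - f (x2 v, y2 v) 0 k) * l k 0).
  move=> t0u uh; have ui : t0 <= u <= t0 + h by rewrite t0u.
  have sub F : mu.-integrable `[t0, t0 + h] F -> mu.-integrable `[t0, u] F.
    apply: integrableS; [exact: measurable_itv_lebesgueR..|].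
    by move=> v/=; rewrite !in_itv/= => /andP[-> vu]; rewrite (le_trans vu).
  rewrite Rintegral_lincomb; [|exact: measurable_itv_lebesgueR|].
    rewrite (x1E _ ui) (x2E _ ui) opprD addrACA mulmxDl mxE; congr (_ + _).
    rewrite mxE; apply: eq_bigr => k _; rewrite !mxE; congr (_ * _).
    by rewrite RintegralB//; [exact: measurable_itv_lebesgueR|exact/sub/i1|exact/sub/i2].
  by move=> k; exact/sub/gi.
rewrite mulmxBl mxE [X in _ + X]mxE (xE t)// 1?(le_trans t0s)//.
rewrite (xE s) ?(le_trans st)// opprD addrACA subrr add0r.
apply: (Rintegral_increment_le (b := t0 + h)) => // [|u su ut].
  by apply: integrable_lincomb => [|k]; [exact: measurable_itv_lebesgueR|exact: gi].
by move: (fK u su ut); rewrite mxE; under eq_bigr do rewrite !mxE.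
Qed.

Lemma weak_solution_init (n m : nat) (f : 'rV[R]_n * 'rV[R]_m -> 'rV[R]_n)
    (y : R -> 'rV[R]_m) (t0 h : R) (a : 'rV[R]_n) (x : R -> 'rV[R]_n) :
  0 <= h -> weak_solution f y t0 h a x -> x t0 = a.
Proof.
move=> h0 [_ fi xE]; rewrite xE ?lexx ?lerDl//.
apply/rowP => k; rewrite !mxE [X in _ + X](_ : _ = 0) ?addr0//.
rewrite /Rintegral null_set_integral//.
- by apply: sub_caratheodory; exact: measurable_itv.
- apply: measurable_int; apply: integrableS (fi 0 k).
  + by apply: sub_caratheodory; exact: measurable_itv.
  + by apply: sub_caratheodory; exact: measurable_itv.
  + by move=> s/=; rewrite !in_itv/= => /andP[-> st]; rewrite (le_trans st)// lerDl.
- suff : @lebesgue_measure R `[t0, t0]%classic = 0%E by [].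
  by rewrite lebesgue_measure_itv/= ltxx.
Qed.

End WeakSolutionIncrement.

(** * The differential inequality for the block errors *)

Lemma convex_set_segment (R : realType) (V : lmodType R) (A : set V) (x y : V)
    (th : R) : convex_set A -> A x -> A y -> 0 <= th <= 1 ->
  A (y + th *: (x - y)).
Proof.
move=> cA Ax Ay /andP[th0 th1].
have := cA x y (Itv01 th0 th1); rewrite !inE => /(_ Ax Ay).
congr (A _); transitivity (th *: x + (1 - th) *: y) => //.
by rewrite scalerBr scalerBl scale1r addrCA.
Qed.

Lemma norm_submxrow_le (R : realType) (p : nat) (n_ : 'I_p -> nat)
    (v : 'rV[R]_(\sum_(i < p) n_ i)) i : `|submxrow v i| <= `|v|.
Proof.
by apply: norm_le_entries => // a b; rewrite !mxE; exact: entry_le_norm.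
Qed.

Section ErrorInequality.
Variables (R : realType) (p m : nat) (n_ : 'I_p -> nat).
Variables (N : forall i : 'I_p, 'rV[R]_(n_ i) -> R) (h t0 : R).
Arguments N : clear implicits.
Notation V := 'rV[R]_(\sum_(i < p) n_ i).
Variables (f : V * 'rV[R]_m -> V) (y : R -> 'rV[R]_m).
Variables (Wy : set 'rV[R]_m) (yc : 'rV[R]_m) (x1 x2 : R -> V) (x0 xbar0 : V).
Variables (W1 W2 : set V) (C : 'cV[R]_p) (J : 'M[R]_p).
Hypotheses (n_gt0 : forall i, (0 < n_ i)%N) (hN : forall i, is_norm (N i)).
Hypotheses (fC1 : C1 f) (ybounded : bounded_set (y @` `[t0, t0 + h])).
Hypotheses (yWy : y @` `[t0, t0 + h] `<=` Wy).
Hypotheses (x1sol : weak_solution f (fun _ => yc) t0 h x0 x1)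
  (x2sol : weak_solution f y t0 h xbar0 x2).
Hypotheses (W12 : W1 `<=` W2) (convW2 : convex_set W2) (compactW2 : compact W2).
Hypothesis xW : forall t, t0 <= t <= t0 + h -> W1 (x1 t) /\ W2 (x2 t).
Hypothesis defect_le : forall i x z, W1 x -> Wy z ->
  N i (submxrow (f (x, yc) - f (x, z)) i) <= C i 0.
Hypothesis diag_le : forall i x z, W2 x -> Wy z ->
  lognorm (N i) (jac_block f i i x z) <= J i i.
Hypothesis offdiag_le : forall i j x z, i != j -> W2 x -> Wy z ->
  opnorm (N j) (N i) (jac_block f i j x z) <= J i j.

Let w i t := N i (submxrow (x1 t - x2 t) i).

Lemma absolutely_continuous_right_near (x : R -> V) s (d : R) : absolutely_continuous t0 (t0 + h) x ->
  t0 <= s -> s < t0 + h -> 0 < d -> \forall k \near 0^'+, `|x s - x (s + k)| <= d.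
Proof.
move=> ac t0s sh d0; have [r r0 xr] := absolutely_continuous_uniform ac d0.
near=> k.
have k0 : 0 < k by near: k; exact: nbhs_right_gt.
rewrite distrC; apply/ltW/xr => //; first by rewrite lerDl ltW.
  rewrite -lerBrDl; near: k.
  by apply: nbhs_right_le; rewrite subr_gt0.
by rewrite addrAC subrr add0r; near: k; exact: nbhs_right_lt.
Unshelve. all: by end_near. Qed.

(** The integral of the right-hand sides over [s, s + k] is an average of Euler
    steps of length [k] from time [s], and a norming functional at the final
    time bounds its norm by the largest of theirs. Each step is bounded whatever
    the value of [y], so the inequality holds at every [s], although [x1] and
    [x2] are differentiable only almost everywhere. *)
Lemma error_dini s i (e : R) : t0 <= s -> s < t0 + h -> 0 < e ->
  \forall k \near 0^'+,
    w i (s + k) <= w i s + k * (\sum_j J i j * w j s + C i 0 + e).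
Proof.
move=> t0s sh e0.
have ss : t0 <= s <= t0 + h by rewrite t0s ltW.
have [W1s W2s] := xW ss; have {}W1s2 := W12 W1s.
have [K K0 NK] := is_norm_le (hN i).
have [M [_ yM]] := ybounded.
pose Qy := [set z : 'rV[R]_m | `|z| <= M + 1].
have cQy : compact Qy.
  apply: bounded_closed_compact.
    exists (M + 1); split=> [|r Mr]; first exact: num_real.
    by move=> z /= zM; rewrite (le_trans zM)// ltW.
  rewrite (_ : Qy = (fun z => `|z|) @^-1` [set r | r <= M + 1])//.
  by apply: closed_comp => [z _|]; [exact: norm_continuous|exact: closed_le].
have yQ u : t0 <= u -> u <= t0 + h -> Qy (y u).
  move=> t0u uh; apply: (yM (M + 1)); first by rewrite ltrDl.
  by exists u => //=; rewrite in_itv/= t0u.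
have yW u : t0 <= u -> u <= t0 + h -> Wy (y u).
  by move=> t0u uh; apply: yWy; exists u => //=; rewrite in_itv/= t0u.
pose D := W2 `*` (y @` `[t0, t0 + h]).
(* [e / 2] is spent on the logarithmic norm, and [e / 4] on freezing each of the
   two solutions at time [s]. *)
pose e1 := e / 2 / (w i s + 1).
have w1 : 0 < w i s + 1 by rewrite ltr_wpDl// is_norm_ge0.
have e10 : 0 < e1 by rewrite !divr_gt0.
have near_lognorm : \forall k \near 0^'+, forall z, D z -> forall v : 'rV[R]_(n_ i),
    N i (v + k *: (v *m jac_block f i i z.1 z.2)) <= (1 + k * (J i i + e1)) * N i v.
  apply: (lognorm_quotient_uniform (Q := W2 `*` Qy)) => //.
  - exact: compact_setX.
  - move=> [a z] [/= W2a [u ui yu]]; split=> //=; rewrite -yu.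
    by move: ui; rewrite /= in_itv/= => /andP[t0u uh]; exact: yQ.
  - by move=> z d d0; exact: jac_block_near.
  - by move=> [a z] [/= W2a yz]; apply: diag_le => //; exact: yWy.
pose e2 := e / 4 / K.
have e20 : 0 < e2 by rewrite !divr_gt0.
have fc := C1_continuous fC1.
have [[ac1 _ _] [ac2 _ _]] := (x1sol, x2sol).
have near1 : \forall k \near 0^'+, forall z, [set yc] z ->
    `|f (x1 s, z) - f (x1 (s + k), z)| <= e2.
  apply: (uniform_near_compact _ _ _ _ e20) => //; first exact: compact_set1.
  by move=> d d0; exact: absolutely_continuous_right_near.
have near2 : \forall k \near 0^'+, forall z, Qy z ->
    `|f (x2 s, z) - f (x2 (s + k), z)| <= e2.
  apply: (uniform_near_compact _ _ _ _ e20) => //.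
  by move=> d d0; exact: absolutely_continuous_right_near.
have [d1 d10 near1'] := at_right0_segment near1.
have [d2 d20 near2'] := at_right0_segment near2.
near=> k.
have k0 : 0 < k by near: k; exact: nbhs_right_gt.
have kd1 : k <= d1 by near: k; exact: nbhs_right_le.
have kd2 : k <= d2 by near: k; exact: nbhs_right_le.
have skh : s + k <= t0 + h.
  by rewrite -lerBrDl; near: k; apply: nbhs_right_le; rewrite subr_gt0.
have quot : forall z, D z -> forall v : 'rV[R]_(n_ i),
    N i (v + k *: (v *m jac_block f i i z.1 z.2)) <= (1 + k * (J i i + e1)) * N i v.
  by near: k.
set B := w i s + k * (\sum_j J i j * w j s + C i 0 + e).
pose E t := submxrow (x1 t - x2 t) i.
pose F u := f (x1 u, yc) - f (x2 u, y u).
(* The Euler step from time [s] with any later value of the right-hand side. *)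
have euler u : s < u -> u <= s + k -> N i (E s + k *: submxrow (F u) i) <= B.
  move=> su usk.
  have t0u : t0 <= u by rewrite (le_trans t0s)// ltW.
  have uh : u <= t0 + h by exact: le_trans skh.
  have yu : (y @` `[t0, t0 + h]) (y u) by exists u => //=; rewrite in_itv/= t0u.
  have us0 : 0 < u - s by rewrite subr_gt0.
  have usk' : u - s <= k by rewrite lerBlDl.
  have r1 := near1' (u - s) us0 (le_trans usk' kd1) yc erefl.
  have r2 := near2' (u - s) us0 (le_trans usk' kd2) (y u) (yQ u t0u uh).
  rewrite subrKC in r1 r2.
  pose G := f (x1 s, y u) - f (x2 s, y u).
  pose delta := f (x1 s, yc) - f (x1 s, y u).
  pose rest := (f (x2 s, y u) - f (x2 u, y u)) - (f (x1 s, yc) - f (x1 u, yc)).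
  have -> : F u = G + delta + rest.
    rewrite /F /G /delta /rest opprB addrACA; apply/esym.
    by rewrite subrKA [X in _ + X]addrC subrKA addrC subrKA.
  have restle : N i (submxrow rest i) <= e / 2.
    rewrite (le_trans (NK _))// -ler_pdivlMl//.
    rewrite (le_trans (norm_submxrow_le _ _))// (le_trans (ler_normB _ _))//.
    rewrite (le_trans (lerD r2 r1))// le_eqVlt; apply/orP; left; apply/eqP.
    by rewrite /e2; field; rewrite gt_eqF.
  have deltale : N i (submxrow delta i) <= C i 0 by apply: defect_le => //; exact: yW.
  have Gle : N i (E s + k *: submxrow G i) <=
      (1 + k * (J i i + e1)) * w i s + k * \sum_(j | j != i) J i j * w j s.
    have seg th : 0 <= th <= 1 -> W2 (x2 s + th *: (x1 s - x2 s)).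
      by move=> th01; exact: convex_set_segment.
    apply: (@block_mean_value _ _ _ _ N f i (x1 s) (x2 s) (y u) k (J i i + e1)
      (fun j => J i j) hN fC1 (ltW k0)).
      by move=> th th01 v; apply: (quot (_, _)); split=> //=; exact: seg.
    move=> th j th01 ij v.
    rewrite (le_trans (opnormP (hN j) (hN i) _ _))// ler_wpM2r ?is_norm_ge0//.
    by apply: offdiag_le => //; [exact: seg|exact: yW].
  rewrite -addrA submxrowD scalerDr addrA.
  rewrite (le_trans (is_normD (hN i) _ _))//.
  have le2 : N i (k *: submxrow (delta + rest) i) <= k * (C i 0 + e / 2).
    rewrite is_normZ// gtr0_norm// ler_wpM2l ?(ltW k0)// submxrowD.
    by rewrite (le_trans (is_normD (hN i) _ _))// lerD.
  rewrite (le_trans (lerD Gle le2))// /B [X in _ <= _ + _ * (X + _ + _)](bigD1 i)//=.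
  have e1w : e1 * w i s <= e / 2.
    by rewrite /e1 mulrAC ler_pdivrMr// ler_wpM2l ?divr_ge0 ?(ltW e0)// lerDl.
  have := ler_wpM2l (ltW k0) e1w.
  set S := \sum_(j | j != i) _ => kw; rewrite -subr_ge0.
  rewrite (_ : _ - _ = k * (e / 2) - k * (e1 * w i s)) ?subr_ge0//.
  by field.
have [l [lN lE]] := norming_functional (E (s + k)) (is_norm_sublinear (hN i)).
pose P := submxrow (1%:M : 'M[R]_(\sum_(i < p) n_ i)) i *m l.
have PE (z : V) : (z *m P) 0 0 = (submxrow z i *m l) 0 0.
  by rewrite mulmxA mul_submxrow mulmx1.
have incr : ((x1 (s + k) - x2 (s + k) - (x1 s - x2 s)) *m P) 0 0 <=
    (B - (E s *m l) 0 0) / k * (s + k - s).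
  apply: (weak_solution_increment_le x1sol x2sol t0s) => //.
    by rewrite lerDl ltW.
  move=> u su usk; rewrite PE ler_pdivlMr// mulrC lerBrDl.
  apply: le_trans (euler u su usk); apply: le_trans (lN _).
  by rewrite mulmxDl [leRHS]mxE -scalemxAl [X in _ <= _ + X]mxE.
rewrite [X in _ * X](_ : _ = k) ?divfK ?gt_eqF// in incr; last first.
  by rewrite addrC addKr.
rewrite -[w i (s + k)]lE.
have -> : E (s + k) = E s + submxrow (x1 (s + k) - x2 (s + k) - (x1 s - x2 s)) i.
  by rewrite [in RHS]submxrowB subrKC.
by rewrite mulmxDl mxE -(PE (_ - _ - _)) -lerBrDl.
Unshelve. all: by end_near. Qed.

End ErrorInequality.

(** * The error estimate *)

Lemma is_derive_right_ge (R : realType) (g : R -> R) (s l e : R) :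
  is_derive s 1 g l -> 0 < e ->
  \forall k \near 0^'+, g s + k * (l - e) <= g (s + k).
Proof.
move=> [gd gl] e0.
have gq : h^-1 *: (g (h *: 1 + s) - g s) @[h --> 0^'+] --> l.
  by rewrite -gl; apply: cvg_dnbhs_at_right; exact: gd.
have : l - e < l by rewrite ltrBlDr ltrDl.
move=> /(cvgr_gt l gq); apply: filter_app; near=> k => /ltW.
have k0 : 0 < k by near: k; exact: nbhs_right_gt.
rewrite [k *: 1]mulr1 /GRing.scale/= ler_pdivlMl// addrC (addrC k).
by rewrite lerBrDl.
Unshelve. all: by end_near. Qed.

Lemma block_error_continuous (R : realType) (p : nat) (n_ : 'I_p -> nat) (i : 'I_p)
    (Ni : 'rV[R]_(n_ i) -> R) (a b : R)
    (x1 x2 : R -> 'rV[R]_(\sum_(i < p) n_ i)) :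
  is_norm Ni -> absolutely_continuous a b x1 -> absolutely_continuous a b x2 ->
  {within `[a, b], continuous (fun t => Ni (submxrow (x1 t - x2 t) i))}.
Proof.
move=> hN ac1 ac2; apply/subspace_continuousP => s /=.
rewrite in_itv/= => /andP[as_ sb].
have [K K0 NK] := is_norm_le hN.
apply/(@cvgrPdist_le _ R^o) => e e0.
have e2 : 0 < e / 2 / K by rewrite !divr_gt0.
have near_x x : absolutely_continuous a b x ->
    \forall t \near within `[a, b] (nbhs s), `|x s - x t| <= e / 2 / K.
  move=> ac; have [d d0 xd] := absolutely_continuous_uniform ac e2.
  apply/nbhs_ballP; exists d => //= t; rewrite /ball/= => st.
  rewrite in_itv/= => /andP[at_ tb].
  have [ts|st'] := leP t s.
    by apply/ltW/xd => //; rewrite (le_lt_trans _ st)// ler_norm.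
  rewrite distrC; apply/ltW/xd => //; first exact: ltW.
  by rewrite (le_lt_trans _ st)// distrC ler_norm.
near=> t.
rewrite (le_trans (is_norm_dist hN _ _))// -submxrowB.
rewrite (le_trans (NK _))// -ler_pdivlMl//.
rewrite (le_trans (norm_submxrow_le _ _))//.
rewrite (_ : _ - _ = (x1 s - x1 t) - (x2 s - x2 t)); last first.
  by rewrite !opprB [x2 t - x1 t]addrC addrACA [- x2 s + _]addrC.
rewrite (le_trans (ler_normB _ _))//.
rewrite [leRHS](_ : _ = e / 2 / K + e / 2 / K); last by field; rewrite gt_eqF.
by apply: lerD; near: t; exact: near_x.
Unshelve. all: by end_near. Qed.


Theorem theorem9 (R : realType) (p m : nat) (n_ : 'I_p -> nat)
    (N : forall i : 'I_p, 'rV[R]_(n_ i) -> R)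
    (h t0 : R)
    (f : 'rV[R]_(\sum_(i < p) n_ i) * 'rV[R]_m -> 'rV[R]_(\sum_(i < p) n_ i))
    (y : R -> 'rV[R]_m)
    (Wy : set 'rV[R]_m) (yc : 'rV[R]_m)
    (x1 x2 : R -> 'rV[R]_(\sum_(i < p) n_ i))
    (x0 xbar0 : 'rV[R]_(\sum_(i < p) n_ i))
    (W1 W2 : set 'rV[R]_(\sum_(i < p) n_ i))
    (C : 'cV[R]_p) (J : 'M[R]_p) :
  (forall i, (0 < n_ i)%N) ->
  (forall i, is_norm (N i)) ->
  0 < h ->
  C1 f ->
  bounded_set (y @` `[t0, t0 + h]) ->
  lebesgue_measurable_mx `[t0, t0 + h] y ->
  convex_set Wy -> y @` `[t0, t0 + h] `<=` Wy -> Wy yc ->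
  weak_solution f (fun _ => yc) t0 h x0 x1 ->
  weak_solution f y t0 h xbar0 x2 ->
  W1 `<=` W2 ->
  convex_set W1 -> compact W1 -> convex_set W2 -> compact W2 ->
  (forall t, t0 <= t <= t0 + h -> W1 (x1 t) /\ W2 (x2 t)) ->
  let Delta := [set f (z.1, yc) - f (z.1, z.2) | z in W1 `*` Wy] in
  (forall i,
     (ereal_sup [set (N i (submxrow delta i))%:E | delta in Delta]
        <= (C i 0)%:E)%E) ->
  (forall i,
     (ereal_sup [set (lognorm (N i) (jac_block f i i z.1 z.2))%:E
                | z in W2 `*` Wy]
        <= (J i i)%:E)%E) ->
  (forall i j, i != j ->
     (ereal_sup [set (opnorm (N j) (N i) (jac_block f i j z.1 z.2))%:E
                | z in W2 `*` Wy]
        <= (J i j)%:E)%E) ->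
  forall t, t0 <= t <= t0 + h -> forall i : 'I_p,
    N i (submxrow (x1 t) i - submxrow (x2 t) i)
    <= (expmx ((t - t0) *: J)
          *m \col_j N j (submxrow x0 j - submxrow xbar0 j)) i 0
       + (int_mx (@lebesgue_measure R) `[t0, t]
            (fun s => expmx ((t - s) *: J) *m C)) i 0.
Proof.
move=> n_gt0 hN h0 fC1 yb _ _ yWy Wyc sol1 sol2 W12 _ _ cW2 kW2 xW Delta HC HJd HJo.
have defect_le i x z : W1 x -> Wy z ->
    N i (submxrow (f (x, yc) - f (x, z)) i) <= C i 0.
  move=> W1x Wyz; rewrite -lee_fin; apply: le_trans (HC i).
  apply: ereal_sup_ubound; exists (f (x, yc) - f (x, z)) => //.
  by exists (x, z).
have diag_le i x z : W2 x -> Wy z ->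
    lognorm (N i) (jac_block f i i x z) <= J i i.
  move=> W2x Wyz; rewrite -lee_fin; apply: le_trans (HJd i).
  by apply: ereal_sup_ubound; exists (x, z).
have offdiag_le i j x z : i != j -> W2 x -> Wy z ->
    opnorm (N j) (N i) (jac_block f i j x z) <= J i j.
  move=> ij W2x Wyz; rewrite -lee_fin; apply: le_trans (HJo i j ij).
  by apply: ereal_sup_ubound; exists (x, z).
have dini := error_dini n_gt0 hN fC1 yb yWy sol1 sol2 W12 cW2 kW2 xW
  defect_le diag_le offdiag_le.
have [[ac1 _ _] [ac2 _ _]] := (sol1, sol2).
have tt0 : t0 <= t0 <= t0 + h by rewrite lexx lerDl ltW.
have J0 i j : i != j -> 0 <= J i j.
  move=> ij; have [_ W2t0] := xW t0 tt0.
  exact: le_trans (opnorm_ge0 (hN j) (hN i) _) (offdiag_le i j _ yc ij W2t0 Wyc).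
pose w0 : 'cV[R]_p := \col_j N j (submxrow x0 j - submxrow xbar0 j).
pose z i s := affine_flow J w0 C i (s - t0).
pose d i s := N i (submxrow (x1 s - x2 s) i) - z i s.
have zd i (s : R) : is_derive s 1 (z i) (\sum_j J i j * z j s + C i 0).
  have sub : is_derive s 1 (fun s => s - t0) 1.
    by rewrite -[X in is_derive _ _ _ X]subr0; exact: is_deriveB.
  have := is_derive1_comp (g := fun s => s - t0)
    (affine_flow_is_derive J w0 C i (s - t0)) sub.
  by rewrite mulr1.
have zc i (s : R) : {for s, continuous (z i)}.
  by apply: differentiable_continuous; apply/derivable1_diffP; case: (zd i s).
move=> t /andP[t0t tb] i.
rewrite -/w0 -(affine_flowE J w0 C i t0t) -submxrowB -subr_le0.
apply: (@dini_nonpos R p t0 (t0 + h) J d) => // {t t0t tb} [{}i|{}i|s j e t0s sb e0].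
- move=> s; apply: continuousB; last exact/continuous_subspaceT/zc.
  exact: block_error_continuous.
- rewrite /d /z subrr affine_flow0 mxE.
  rewrite (weak_solution_init (ltW h0) sol1) (weak_solution_init (ltW h0) sol2).
  by rewrite submxrowB subrr.
- have e2 : 0 < e / 2 by rewrite divr_gt0.
  have := is_derive_right_ge (zd j s) e2; have := dini s j (e / 2) t0s sb e2.
  apply: filterS2 => k wk zk; apply: le_trans (lerB wk zk) _.
  rewrite le_eqVlt; apply/orP; left; apply/eqP.
  under [in RHS]eq_bigr do rewrite mulrBr.
  by rewrite sumrB /d; field.
Qed.
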